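(* Let $\mathbb{X}$ be a two-dimensional real Banach space such that the unit sphere $S_{\mathbb{X}}$ is a polygon with $4n$ vertices, where $n \in \mathbb{N}$. Then $\mathbb{X}$ is not a Radon plane.
   Context: Here $\mathbb{N} = \{1, 2, 3, \dots\}$. For a two-dimensional real Banach space $(\mathbb{X}, \|\cdot\|)$, $B_{\mathbb{X}} = \{x : \|x\| \le 1\}$ and $S_{\mathbb{X}} = \{x : \|x\| = 1\}$. $S_{\mathbb{X}}$ is a polygon if $B_{\mathbb{X}}$ has only finitely many extreme points; these extreme points are the vertices of $S_{\mathbb{X}}$. Birkhoff-James orthogonality: $x \perp_B y$ means $\|x + \lambda y\| \ge \|x\|$ for all $\lambda \in \mathbb{R}$. $\mathbb{X}$ is a Radon plane if $\perp_B$ is symmetric, i.e. $x \perp_B y$ implies $y \perp_B x$ for all $x, y \in \mathbb{X}$. *)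

(* Defs.v *)
From HB Require Import structures.
From mathcomp Require Import all_boot all_order all_algebra.
From mathcomp Require Import all_classical all_reals all_analysis.
Set Implicit Arguments.
Unset Strict Implicit.
Unset Printing Implicit Defensive.
Import Order.TTheory GRing.Theory Num.Theory.
Import numFieldNormedType.Exports.
Local Open Scope classical_set_scope.
Local Open Scope convex_scope.
Local Open Scope ring_scope.

(* Inhabitation of the datum from which a [vectType] of dimension [n] is
   built, i.e. a linear bijection from [V] to ['rV[R]_n]. *)
Definition has_dim (R : realType) (n : nat) (V : lmodType R) : Prop :=
  $| Vector.axiom n V |.

Definition unit_ball (R : realType) (X : normedModType R) : set X :=
  [set x | `|x| <= 1].

Definition extreme_points (R : realType) (V : lmodType R)
    (A : set (convex_lmodType V)) : set (convex_lmodType V) :=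
  [set x | A x /\ forall (y z : convex_lmodType V) (t : {i01 R}),
     A y -> A z -> 0 < t%:num -> t%:num < 1 ->
     x = y <| t |> z -> y = x /\ z = x].

Definition vertices (R : realType) (X : normedModType R) : set X :=
  extreme_points (@unit_ball R X).

Definition polygonal (R : realType) (X : normedModType R) : Prop :=
  finite_set (@vertices R X).

Definition BJ_orthogonal (R : realType) (X : normedModType R) (x y : X) : Prop :=
  forall lambda : R, `|x + lambda *: y| >= `|x|.

(* The dimension is not part of this predicate: it is only used for spaces [X]
   assumed to be two-dimensional. *)
Definition Radon_plane (R : realType) (X : normedModType R) : Prop :=
  forall x y : X, BJ_orthogonal x y -> BJ_orthogonal y x.

(* Main.v *)
Require Import Defs.
From HB Require Import structures.
From mathcomp Require Import all_boot all_order all_algebra.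
From mathcomp Require Import all_classical all_reals all_analysis.
From mathcomp Require Import zify ring lra.
Import Order.TTheory GRing.Theory Num.Theory.
Import numFieldNormedType.Exports.
Local Open Scope classical_set_scope.
Local Open Scope card_scope.
Local Open Scope ring_scope.

(* Let w be the determinant form on X and h v the maximum of w v on the unit
   ball. In a Radon plane the points where w v is maximal on the ball are exactly
   the unit vectors y (suitably oriented) with v BJ-orthogonal to y; as a vertex
   v of a polygon has more than one supporting line, these points form an edge
   [a, b], the dual edge of v, and moreover h a = h b = h v. Sending each vertex
   to the initial point of its dual edge maps the vertices after v and up to a
   injectively to the vertices from b on and before - v; reversing the
   orientation gives an injection the other way. So each open half plane bounded
   by the line through v contains an even number 2k of vertices, and with v and
   - v there are 4k + 2 vertices in total. *)

(** * Counting the vertices by means of dual edges *)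

Section RadonPolygonCounting.
Context {R : realFieldType} {X : zmodType} (s : seq X) (h : X -> R).

Definition dual_edge (w : X -> X -> R) (v a b : X) : Prop :=
  [/\ v \in s, a \in s, b \in s, 0 < w a b &
      [/\ w v a = h v, w v b = h v, h a = h v & h b = h v]].

(* [w] is the determinant form and [h x] the maximum of [w x] on the polygon. *)
Record radon_polygon (w : X -> X -> R) : Prop := RadonPolygon {
  rp_opp : forall x, x \in s -> - x \in s;
  rp_gt0 : forall x, x \in s -> 0 < h x;
  rp_hN : forall x, h (- x) = h x;
  rp_anti : forall x y, w x y = - w y x;
  rp_wN : forall x y, w (- x) y = - w x y;
  rp_plucker : forall x y z t, w x y * w z t = w x z * w y t - w x t * w y z;
  rp_le : forall x y, x \in s -> y \in s -> w x y <= h x;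
  rp_eq0 : forall x y, x \in s -> y \in s -> w x y = 0 -> y = x \/ y = - x;
  rp_dual : forall v, v \in s -> exists a b, dual_edge w v a b;
  rp_adjacent : forall v a b z,
    v \in s -> a \in s -> b \in s -> z \in s -> 0 < w a b ->
    w v a = h v -> w v b = h v -> 0 < w a z -> 0 < w z b -> False }.

Lemma rp_wNr w (rp : radon_polygon w) x y : w x (- y) = - w x y.
Proof. by rewrite (rp_anti _ rp) (rp_wN _ rp) opprK (rp_anti _ rp). Qed.

(** Reversing the orientation lets each inequality between vertex counts yield its converse. *)
Lemma rp_flip w : radon_polygon w -> radon_polygon (fun x y => - w x y).
Proof.
move=> rp; have wNr := rp_wNr _ rp.
case: rp => sN h0 hN wC wN wP wle w0 wd wa; split => //.
- by move=> x y; rewrite wC.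
- by move=> x y; rewrite wN.
- by move=> x y z t; rewrite !mulrNN.
- by move=> x y xs ys; rewrite -wNr wle ?sN.
- by move=> x y xs ys /eqP; rewrite oppr_eq0 => /eqP; exact: w0.
- move=> v vs; have [a [b [_ as_ bs ab [va vb ha hb]]]] := wd _ vs.
  (* For [- w] the dual edge of [v] is the opposite edge, traversed the other way. *)
  exists (- b), (- a); split; rewrite ?sN ?hN //.
    by rewrite wN wNr opprK -wC.
  by split=> //; rewrite wNr opprK.
- move=> v a b z vs as_ bs zs ab va vb az zb.
  by apply: (wa (- v) b a z); rewrite ?sN ?wN ?hN // wC.
Qed.

Lemma rp_norm_le w (rp : radon_polygon w) x y :
  x \in s -> y \in s -> `|w x y| <= h x.
Proof.
move=> xs ys; rewrite ler_norml (rp_le _ rp) // andbT.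
by rewrite lerNl -(rp_wNr _ rp) (rp_le _ rp) // (rp_opp _ rp).
Qed.

(* The Pluecker identities on (v, u, a, d) and (v, u, a, b) give opposite signs. *)
Lemma dual_edge_inj w (rp : radon_polygon w) v u a b d :
  dual_edge w v a b -> dual_edge w u a d -> w v u = 0.
Proof.
move=> [vs as_ bs ab [va vb ha hb]] [us _ ds ad [ua ud ha' hd]].
have hv0 := rp_gt0 _ rp _ vs.
have huv : h u = h v by rewrite -ha' ha.
have P1 := rp_plucker _ rp v u a d; have P2 := rp_plucker _ rp v u a b.
have vd := rp_le _ rp _ _ vs ds; have ub := rp_le _ rp _ _ us bs.
rewrite va ud ua huv in P1; rewrite va ua vb huv in P2; rewrite huv in ub.
apply/eqP; rewrite eq_le; apply/andP; split.
  by rewrite -(pmulr_lle0 _ ab) P2; nra.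
by rewrite -(pmulr_lge0 _ ad) P1; nra.
Qed.

(** By the Pluecker identity [w v z * w a b = h v * (w z b - w z a)], where the left side is
    positive and the right side is not. *)
Lemma before_after_excl w (rp : radon_polygon w) v a b z :
  dual_edge w v a b -> 0 < w v z -> 0 <= w z a -> 0 <= w b z -> False.
Proof.
move=> [vs as_ bs ab [va vb ha hb]] vz za bz.
have hv0 := rp_gt0 _ rp _ vs.
have P := rp_plucker _ rp v z a b; rewrite va vb (rp_anti _ rp z b) in P.
by have := mulr_gt0 vz ab; nra.
Qed.

(** As [u] moves from [v] to [a], its dual edge moves on from [[a, b]] towards [- v]; this places
    the initial point [c]. *)
Lemma dual_edge_shift w (rp : radon_polygon w) v a b u c d :
  dual_edge w v a b -> dual_edge w u c d -> 0 < w v u -> 0 <= w u a ->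
  0 < w v c /\ 0 <= w b c.
Proof.
move=> Dv Du vu ua.
have ub : 0 < w u b.
  rewrite ltNge; apply/negP => ub; apply: (before_after_excl _ rp _ _ _ u Dv) => //.
  by rewrite (rp_anti _ rp) oppr_ge0.
have inj := dual_edge_inj _ rp _ _ _ _ _ Dv.
have [vs as_ bs ab [va vb ha hb]] := Dv; have [us cs ds cd [uc ud hc hd]] := Du.
have hv0 := rp_gt0 _ rp _ vs; have hu0 := rp_gt0 _ rp _ us.
(* Here [w u b * w v d = h u * h v - w v u * w b d], with [w v u <= h u] and [w b d <= h v]. *)
have vd : 0 <= w v d.
  have P := rp_plucker _ rp u b d (- v).
  rewrite !(rp_wNr _ rp) (rp_anti _ rp d v) (rp_anti _ rp b v) (rp_anti _ rp u v)
    !opprK ud vb in P.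
  have vuN := rp_norm_le _ rp _ _ us vs; rewrite (rp_anti _ rp) normrN gtr0_norm // in vuN.
  have bd := rp_le _ rp _ _ bs ds; rewrite hb in bd.
  by rewrite -(pmulr_rge0 _ ub) P; nra.
have vc : 0 < w v c.
  have P := rp_plucker _ rp v u c d; rewrite uc ud in P.
  by have := mulr_gt0 vu cd; nra.
split=> //.
have vc_le := rp_le _ rp _ _ vs cs; have ua_le := rp_le _ rp _ _ us as_.
have P := rp_plucker _ rp v u a c; rewrite va uc in P.
have ac0 : 0 <= w a c by rewrite -(pmulr_rge0 _ vu) P; nra.
rewrite leNgt; apply/negP => bc.
have cb : 0 < w c b by rewrite (rp_anti _ rp) oppr_gt0.
(* If [c] came before [b], it would lie strictly inside the edge or be [a] or [- a]. In the case
   [c = a], two dual edges share their initial point, so [w v u = 0]. *)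
move: ac0; rewrite le_eqVlt => /orP[/eqP ac|ac]; last first.
  exact: (rp_adjacent _ rp v a b c).
have [ca|ca] := rp_eq0 _ rp _ _ as_ cs (esym ac).
  by move: vu; rewrite (inj u d) ?ltxx // -ca.
by move: vc; rewrite ca (rp_wNr _ rp) va oppr_gt0 ltNge ltW.
Qed.

Lemma before_le_after w (rp : radon_polygon w) v a b :
  uniq s -> dual_edge w v a b ->
  (count (fun z => (0 < w v z)%R && (0 <= w z a)%R) s
     <= count (fun z => (0 < w v z)%R && (0 <= w b z)%R) s)%N.
Proof.
move=> us Dv.
(* [f] picks the initial point of a dual edge; its value [0] outside [s] is a mere default. *)
have /choice[f fP] : forall u, exists c, u \in s -> exists d, dual_edge w u c d.
  move=> u; have [/(rp_dual _ rp)[c [d Du]]|_] := boolP (u \in s); last by exists 0.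
  by exists c => _; exists d.
rewrite -!size_filter -(size_map f); apply: uniq_leq_size.
  rewrite map_inj_in_uniq ?filter_uniq // => x y.
  rewrite !mem_filter => /andP[/andP[vx _] xs] /andP[/andP[vy _] ys] fxy.
  have [[d Dx] [d' Dy]] := (fP _ xs, fP _ ys).
  rewrite fxy in Dx; have xy0 := dual_edge_inj _ rp _ _ _ _ _ Dx Dy.
  have [//|yx] := rp_eq0 _ rp _ _ xs ys xy0.
  by move: vy; rewrite yx (rp_wNr _ rp) oppr_gt0 ltNge ltW.
move=> _ /mapP[x + ->]; rewrite !mem_filter => /andP[/andP[vx xa] xs].
have [d Dx] := fP _ xs; have [-> ->] := dual_edge_shift _ rp _ _ _ _ _ _ Dv Dx vx xa.
by case: Dx.
Qed.

Lemma size_radon_polygon w (rp : radon_polygon w) :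
  uniq s -> s != [::] -> exists k, size s = (4 * k + 2)%N.
Proof.
move=> us; case: {2}s (erefl s) => [->//|v t st] _.
have vs : v \in s by rewrite st mem_head.
have [a [b Dv]] := rp_dual _ rp _ vs.
have [_ as_ bs ab [va vb ha hb]] := Dv.
have hv0 := rp_gt0 _ rp _ vs; have h2 := rp_wNr _ rp.
have vv : w v v = 0.
  by have := rp_anti _ rp v v; lra.
have vN : v != - v.
  by apply/eqP => vNv; have := rp_wN _ rp v a; rewrite -vNv va; lra.
pose A := count (fun z => (0 < w v z) && (0 <= w z a)) s.
pose B := count (fun z => (0 < w v z) && (0 <= w b z)) s.
have AB : A = B.
  apply/eqP; rewrite eqn_leq before_le_after //=.
  (* With [- w] and [- v] in place of [w] and [v], the ends of the dual edge swap roles, and so do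
     the two counts. *)
  have Dv' : dual_edge (fun x y => - w x y) (- v) b a.
    split; rewrite ?(rp_hN _ rp) ?(rp_opp _ rp) //; first by rewrite -(rp_anti _ rp).
    by rewrite !(rp_wN _ rp) !opprK.
  have := before_le_after _ (rp_flip _ rp) _ _ _ us Dv'.
  congr (_ <= _)%N; apply: eq_count => z /=.
    by rewrite (rp_wN _ rp) opprK -(rp_anti _ rp).
  by rewrite (rp_wN _ rp) opprK -(rp_anti _ rp).
(* Adjacency of [a] and [b] puts each vertex after [v] into at least one of the two classes,
   [before_after_excl] into at most one. *)
have posAB : count (fun z => 0 < w v z) s = (A + B)%N.
  rewrite -count_predUI -[LHS]addn0; congr addn.
    apply: eq_in_count => z zs /=.
    rewrite -andb_orr; case: ltP => //= vz.
    case: leP => //= za; case: leP => // bz.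
    exfalso; apply: (rp_adjacent _ rp v a b z) => //.
      by rewrite (rp_anti _ rp) oppr_gt0.
    by rewrite (rp_anti _ rp) oppr_gt0.
  apply/esym/eqP; rewrite -leqn0 leqNgt -has_count; apply/hasP => -[z zs /=].
  by move=> /andP[/andP[vz za] /andP[_ bz]]; exact: (before_after_excl _ rp _ _ _ z Dv).
have negpos : count (fun z => w v z < 0) s = count (fun z => 0 < w v z) s.
  have sN : perm_eq s (map -%R s).
    apply: uniq_perm => //; first by rewrite map_inj_uniq //; exact: oppr_inj.
    move=> z; apply/idP/mapP => [zs|[y ys ->]]; last exact: (rp_opp _ rp).
    by exists (- z); rewrite ?opprK ?(rp_opp _ rp).
  rewrite (permP sN) count_map; apply: eq_count => z /=.
  by rewrite h2 oppr_lt0.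
have zero : count (fun z => w v z == 0) s = 2.
  rewrite -size_filter; apply: (@perm_size _ _ [:: v; - v]).
  apply: uniq_perm; rewrite ?filter_uniq //= ?inE ?vN // => z.
  rewrite mem_filter !inE; apply/andP/orP => [[/eqP vz zs]|[]/eqP ->].
  - by case: (rp_eq0 _ rp _ _ vs zs vz) => ->; [left|right].
  - by rewrite vv eqxx.
  - by rewrite h2 vv oppr0 eqxx (rp_opp _ rp).
exists A; rewrite -(count_predC (fun z => 0 < w v z)) posAB -AB.
have -> : count (predC (fun z => 0 < w v z)) s =
    (count (fun z => w v z < 0)%R s + count (fun z => w v z == 0)%R s)%N.
  rewrite -count_predUI [X in (_ + X)%N](_ : _ = 0%N); last first.
    apply/eqP; rewrite -leqn0 leqNgt -has_count; apply/hasP => -[z _ /=].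
    by move=> /andP[vz /eqP v0]; rewrite v0 ltxx in vz.
  by rewrite addn0; apply: eq_count => z /=; rewrite -leNgt le_eqVlt orbC.
by rewrite zero negpos posAB -AB; lia.
Qed.

End RadonPolygonCounting.

(** * Finite-dimensional topology and extreme points *)

Lemma linear_rV_continuous {R : realType} {X : normedModType R} n
  (g : {linear 'rV[R]_n -> X}) : continuous g.
Proof.
have -> : (g : _ -> _) = (fun r => \sum_(i < n) r ord0 i *: g (delta_mx ord0 i)).
  apply/funext => r; rewrite {1}(row_sum_delta r) linear_sum.
  by apply: eq_bigr => i _; rewrite linearZ.
apply: continuous_big => [|i _ r]; first exact: add_continuous.
apply: cvgZr_tmp; first exact: (nbhs_filter r).
exact: (@coord_continuous R 1 n ord0 i r).
Qed.

(** If [m] is the minimum of the norm of [g r] over the unit sphere of row vectors, then [m > 0] by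
    injectivity, and [f] is bounded by [1 / m]. *)
Lemma coordinates_continuous {R : realType} {X : normedModType R} n
  (f : {linear X -> 'rV[R]_n}) : bijective f -> continuous f.
Proof.
move=> [g' fK gK]; have gl := can2_linear fK gK.
pose g : {linear 'rV[R]_n -> X} := HB.pack g' (GRing.isLinear.Build _ _ _ _ g' gl).
have cg := linear_rV_continuous _ g.
pose S := [set r : 'rV[R]_n | `|r| = 1].
have cng : continuous (fun r => `|g r|).
  by move=> r; apply: continuous_comp; [exact: cg|exact: norm_continuous].
have cS : compact S.
  apply: bounded_closed_compact.
    by exists 1; split=> // M M1 r /= ->; exact: ltW.
  rewrite -[S]/(Num.norm @^-1` [set 1]); apply: closed_comp => [r _|].
    exact: norm_continuous.
  exact: closed_eq.
have [m m0 Sm] : exists2 m, 0 < m & forall r, S r -> m <= `|g r|.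
  (* The sphere is empty when [n = 0]; any positive bound then serves. *)
  have [S0|/nonemptyPn S0] := pselect (S !=set0); last first.
    by exists 1 => // r Sr; move: (Sr); rewrite S0.
  have [r rS rmin] := compact_EVT_min S0 cS (continuous_subspaceT cng).
  rewrite inE in rS.
  exists `|g r| => [|t tS]; last by apply: rmin; rewrite inE.
  rewrite normr_gt0; apply/eqP => gr0; move: rS.
  rewrite /S /= -(gK r) -[g' r]/(g r) gr0 linear0 normr0 => /esym/eqP.
  by rewrite oner_eq0.
apply: bounded_linear_continuous; apply/bounded_funP => c; exists (c / m) => x xc.
have [->|fx0] := eqVneq (f x) 0.
  by rewrite normr0 divr_ge0 ?(ltW m0) // (le_trans _ xc).
have fx : 0 < `|f x| by rewrite normr_gt0.
have := Sm (`|f x|^-1 *: f x); rewrite linearZ /= normrZ fK.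
rewrite /S /= normrZ normfV normr_id mulVf ?gt_eqF // => /(_ erefl).
rewrite mulrC ler_pdivlMr // => mx.
by rewrite ler_pdivlMr // mulrC (le_trans mx).
Qed.

Lemma compact_unit_ball {R : realType} {X : normedModType R} n
  (f : {linear X -> 'rV[R]_n}) : bijective f -> compact (@unit_ball R X).
Proof.
move=> bf; have cf := coordinates_continuous _ f bf.
case: bf => g' fK gK; have gl := can2_linear fK gK.
pose g : {linear 'rV[R]_n -> X} := HB.pack g' (GRing.isLinear.Build _ _ _ _ g' gl).
have cg := linear_rV_continuous _ g.
have -> : @unit_ball R X = g @` (g @^-1` (@unit_ball R X)).
  apply/seteqP; split=> [x x1|_ [r r1 <-]] //; exists (f x); last exact: fK.
  by rewrite /preimage /= fK.
apply: continuous_compact; first exact: continuous_subspaceT.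
apply: bounded_closed_compact.
  have /linear_bounded_continuous/bounded_funP/(_ 1)[M fM] := cf.
  exists M; split; first exact: num_real.
  move=> N MN r r1; have := fM (g r) r1.
  by rewrite /= gK => rM; exact: le_trans rM (ltW MN).
apply: closed_comp => [r _|]; first exact: cg.
have -> : @unit_ball R X = Num.norm @^-1` [set c : R | c <= 1] by [].
apply: closed_comp => [x _|].
  exact: norm_continuous.
exact: closed_le.
Qed.

Lemma convex_comb_max {R : realFieldType} (t x y m : R) :
  0 < t -> t < 1 -> x <= m -> y <= m -> m = t * x + (1 - t) * y ->
  x = m /\ y = m.
Proof. by move=> *; split; nra. Qed.

(** The lexicographic maximum of [(f, g)] is extreme: the ends of a segment through it must agree
    with it under [f], then under [g], and the two functionals separate points. *)
Lemma extreme_lexmax {R : realType} {X : normedModType R} (A : set X)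
  (f g : {scalar X}) :
  A !=set0 -> compact A -> continuous f -> continuous g ->
  (forall x, f x = 0 -> g x = 0 -> x = 0) ->
  exists2 w, extreme_points A w &
    forall z, A z -> f z <= f w /\ (f z = f w -> g z <= g w).
Proof.
move=> A0 cA cf cg inj.
have [m mA fm] := compact_EVT_max A0 cA (continuous_subspaceT cf).
rewrite inE in mA.
pose F := A `&` f @^-1` [set f m].
have cF : compact F.
  apply: compact_closedI => //; apply: closed_comp => [x _|]; first exact: cf.
  exact: closed_eq.
have [w wF gw] := compact_EVT_max (ex_intro _ m (conj mA erefl)) cF
  (continuous_subspaceT cg).
move: wF; rewrite inE => -[wA fw]; rewrite /= in fw.
have max z : A z -> f z <= f w by move=> zA; rewrite fw fm // inE.
have lex z : A z -> f z = f w -> g z <= g w.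
  by move=> zA fz; apply: gw; rewrite inE; split=> //=; rewrite fz.
exists w; last by move=> z zA; split; [exact: max|exact: lex].
split=> // y z t yA zA t0 t1 wyz.
have wE : w = t%:num *: y + (1 - t%:num) *: z by [].
have split_max (k : {scalar X}) : k y <= k w -> k z <= k w ->
    k y = k w /\ k z = k w.
  move=> ky kz; apply: (convex_comb_max t%:num) => //.
  by rewrite {1}wE linearD !linearZ.
have [fy fz] := split_max f (max _ yA) (max _ zA).
have [gy gz] := split_max g (lex _ yA fy) (lex _ zA fz).
by split; apply/eqP; rewrite -subr_eq0; apply/eqP; apply: inj;
  rewrite linearB ?fy ?fz ?gy ?gz subrr.
Qed.

(** * The determinant form on a Radon plane *)

Section AreaForm.
Context {R : realType} {X : lmodType R} (f : {linear X -> 'rV[R]_2}).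

Definition area (x y : X) : R :=
  f x ord0 ord0 * f y ord0 ord_max - f x ord0 ord_max * f y ord0 ord0.

Lemma area_linear x : scalar (area x).
Proof. by move=> c y z; rewrite /area linearP !mxE; ring. Qed.

HB.instance Definition _ x :=
  GRing.isLinear.Build R X R _ (area x) (area_linear x).

Lemma area_anti x y : area x y = - area y x.
Proof. by rewrite /area; ring. Qed.

Lemma areaxx x : area x x = 0.
Proof. by rewrite /area; ring. Qed.

Lemma areaDr x y z : area x (y + z) = area x y + area x z.
Proof. exact: linearD. Qed.

Lemma areaNr x y : area x (- y) = - area x y.
Proof. exact: linearN. Qed.

Lemma areaZr c x y : area x (c *: y) = c * area x y.
Proof. exact: linearZ. Qed.

Lemma areaPl c x y z : area (c *: x + y) z = c * area x z + area y z.
Proof. by rewrite area_anti area_linear [area z x]area_anti [area z y]area_anti; ring. Qed.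

Lemma areaNl x y : area (- x) y = - area x y.
Proof. by rewrite area_anti linearN /= opprK area_anti. Qed.

Lemma areaZl c x y : area (c *: x) y = c * area x y.
Proof. by rewrite area_anti linearZ /= [area y x]area_anti mulrN opprK. Qed.

Lemma area_plucker x y z t :
  area x y * area z t = area x z * area y t - area x t * area y z.
Proof. by rewrite /area; ring. Qed.

Context (bf : bijective f).

(** Cramer's rule in the plane, free of division. *)
Lemma area_expand x y z :
  area x y *: z = area z y *: x + area x z *: y.
Proof.
apply: (bij_inj bf); apply/matrixP => i j; rewrite (ord1 i) linearD !linearZ !mxE.
have [->|->] : j = ord0 \/ j = ord_max.
  by case: j => -[|[|//]] ?; [left|right]; apply: val_inj.
all: by rewrite /area; ring.
Qed.

Lemma area_nondegenerate x : x != 0 -> exists y, 0 < area x y.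
Proof.
move=> x0; have [g fK gK] := bf.
(* The witness is [x] turned by a right angle in coordinates, so that the determinant is a sum of
   two squares. *)
exists (g (\row_j if j == ord0 then - f x ord0 ord_max else f x ord0 ord0)).
rewrite /area gK !mxE /= mulrN opprK -!expr2 lt_neqAle addr_ge0 ?sqr_ge0 // andbT.
rewrite eq_sym paddr_eq0 ?sqr_ge0 // !sqrf_eq0; apply: contra x0 => /andP[/eqP x1 /eqP x2].
apply/eqP; apply: (bij_inj bf); rewrite linear0; apply/matrixP => i j.
rewrite (ord1 i) mxE; case: j => -[|[|//]] ?.
  by rewrite -[RHS]x1; congr (f x _ _); apply: val_inj.
by rewrite -[RHS]x2; congr (f x _ _); apply: val_inj.
Qed.

Lemma area_inj x y z : area x y != 0 -> area x z = 0 -> area y z = 0 -> z = 0.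
Proof.
move=> xy xz yz; apply/eqP; have /eqP := area_expand x y z.
by rewrite xz [area z y]area_anti yz oppr0 !scale0r addr0 scaler_eq0 (negbTE xy).
Qed.

End AreaForm.

(** * Birkhoff-James orthogonality through the determinant form *)

Section RadonPlaneArea.
Context {R : realType} {X : normedModType R} (f : {linear X -> 'rV[R]_2}).
Context (bf : bijective f).
Local Notation area := (area f).
Local Notation V := (@vertices R X).

Lemma area_continuous x : continuous (area x).
Proof.
have cf := coordinates_continuous _ f bf.
have cfij i j : continuous (fun y => f y i j).
  move=> y; apply: (@continuous_comp _ _ _ f (fun M : 'rV[R]_2 => M i j)).
    exact: cf.
  exact: coord_continuous.
by move=> y; rewrite /area; apply: cvgB; apply: cvgM; (exact: cvg_cst || exact: cfij).
Qed.

Lemma scalar_le_norm (k : {scalar X}) c :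
  (forall z, `|z| <= 1 -> k z <= c) -> forall z, k z <= c * `|z|.
Proof.
move=> kc z; have [->|z0] := eqVneq z 0; first by rewrite linear0 normr0 mulr0.
have nz : 0 < `|z| by rewrite normr_gt0.
have := kc (`|z|^-1 *: z).
rewrite normrZ normfV normr_id mulVf ?gt_eqF // lexx => /(_ isT).
by rewrite linearZ /= mulrC ler_pdivrMr.
Qed.

(** Both sides say that the line through [x] in direction [y] supports the ball at [x]: the form
    [area^~ y] is constant on it, and any [z] with [area z y > 0] is a positive multiple of one of
    its points. *)
Lemma BJ_area x y : `|x| = 1 -> 0 < area x y ->
  BJ_orthogonal x y <-> forall z, area z y <= area x y * `|z|.
Proof.
move=> x1 xy; split=> [xBy z|xy_max l].
  have [zy|zy] := leP (area z y) 0.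
    by rewrite (le_trans zy) // mulr_ge0 // ltW.
  have := xBy (area x z / area z y); rewrite x1 => le1.
  have e : area x y *: z = area z y *: (x + (area x z / area z y) *: y).
    by rewrite (area_expand f bf) scalerDr scalerA mulrCA divff ?mulr1 // gt_eqF.
  have := congr1 Num.norm e; rewrite !normrZ !gtr0_norm // => ->.
  by rewrite ler_pMr.
have := xy_max (x + l *: y).
rewrite addrC areaPl areaxx mulr0 add0r x1 addrC.
by rewrite ler_pMr.
Qed.

Lemma BJ_oppr (x y : X) : BJ_orthogonal x y -> BJ_orthogonal x (- y).
Proof. by move=> xy l; rewrite scalerN -scaleNr. Qed.

Context (radonX : Radon_plane X).

(** By [BJ_area] the first condition is orthogonality of [y] to [- x] and the second that of [x] to
    [y]; symmetry exchanges them. *)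
Lemma Radon_plane_area x y : `|x| = 1 -> `|y| = 1 -> 0 < area x y ->
  (forall z, area x z <= area x y * `|z|) <->
  (forall z, area z y <= area x y * `|z|).
Proof.
move=> x1 y1 xy.
have yNx : area y (- x) = area x y by rewrite linearN -area_anti.
have yNx0 : 0 < area y (- x) by rewrite yNx.
have BJy : BJ_orthogonal y (- x) <-> forall z, area x z <= area x y * `|z|.
  rewrite (BJ_area _ _ y1 yNx0) yNx; split=> H z; have := H z;
    by rewrite linearN -area_anti.
rewrite -BJy -(BJ_area _ _ x1 xy); split=> [H|/radonX]; last exact: BJ_oppr.
by apply: radonX; rewrite -[x]opprK; exact: BJ_oppr.
Qed.

(** * Vertices of the unit ball and supporting functionals *)

Lemma vertexP v : V v -> forall y z (t : R), `|y| <= 1 -> `|z| <= 1 ->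
  0 < t -> t < 1 -> v = t *: y + (1 - t) *: z -> y = v /\ z = v.
Proof.
move=> [_ vext] y z t y1 z1 t0 t1 vE.
by apply: (vext y z (Itv01 (ltW t0) (ltW t1))).
Qed.

Lemma vertex_opp v : V v -> V (- v).
Proof.
move=> vV; split; first by rewrite /unit_ball /= normrN; case: vV.
move=> y z t y1 z1 t0 t1 vE.
have [] := vertexP _ vV (- y) (- z) t%:num; rewrite ?normrN //.
  by apply: oppr_inj; rewrite vE !scalerN -opprD opprK.
by move=> yv zv; split; apply: oppr_inj; rewrite opprK.
Qed.

Lemma exists_area_gt0 : exists x y : X, 0 < area x y.
Proof.
have [g fK gK] := bf; pose x := g (const_mx 1); exists x.
apply: area_nondegenerate => //; apply/eqP => x0.
have /matrixP/(_ ord0 ord0) := gK (const_mx 1); rewrite -/x x0 linear0 !mxE => /esym/eqP.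
by rewrite oner_eq0.
Qed.

(** A nonzero interior point lies strictly between [0] and its normalization, and [0] is the
    midpoint of two opposite unit vectors. *)
Lemma vertex_norm1 v : V v -> `|v| = 1.
Proof.
move=> vV; have v1 : `|v| <= 1 by case: vV.
apply/eqP; rewrite eq_le v1 leNgt; apply/negP => lt1.
have [v0|v0] := eqVneq v 0.
  have [x [y xy]] := exists_area_gt0.
  have x0 : x != 0.
    by apply/eqP => x0; move: xy; rewrite x0 area_anti linear0 oppr0 ltxx.
  have nx : `|(`|x|^-1 *: x)| = 1 by rewrite normrZ normfV normr_id mulVf // normr_eq0.
  have [h0 [h1 h2]] : 0 < 2^-1 :> R /\ 2^-1 < 1 :> R /\ 1 - 2^-1 = 2^-1 :> R.
    by split; [|split]; lra.
  have [] := vertexP _ vV (`|x|^-1 *: x) (- (`|x|^-1 *: x)) 2^-1;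
    rewrite ?normrN ?nx // ?h2 ?v0; first by rewrite scalerN subrr.
  by move=> u0; move: nx; rewrite u0 normr0 => /esym/eqP; rewrite oner_eq0.
have nv : 0 < `|v| by rewrite normr_gt0.
have [] := vertexP _ vV (`|v|^-1 *: v) 0 `|v|; rewrite ?normr0 //.
- by rewrite normrZ normfV normr_id mulVf // gt_eqF.
- by rewrite scalerA divff ?gt_eqF // scale1r scaler0 addr0.
- by move=> _ /esym/eqP; rewrite (negbTE v0).
Qed.

(** The functional [area q] breaks ties, selecting one end of the face on which [area p] is
    maximal. *)
Lemma vertex_lexmax p q : area p q != 0 ->
  exists2 w, V w & forall z, `|z| <= 1 ->
    area p z <= area p w /\ (area p z = area p w -> area q z <= area q w).
Proof.
move=> pq; apply: (@extreme_lexmax _ _ (@unit_ball R X) (area p) (area q)).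
- by exists 0; rewrite /unit_ball /= normr0.
- exact: (compact_unit_ball _ f bf).
- exact: area_continuous.
- exact: area_continuous.
- by move=> z pz qz; exact: (area_inj f bf p q).
Qed.

(** A linear functional attains its maximum over the ball at some vertex. *)
Lemma area_le_vertices x y : area x y != 0 ->
  (forall w, V w -> area w y <= area x y) ->
  forall z, area z y <= area x y * `|z|.
Proof.
move=> xy Vle z; rewrite area_anti -areaNl.
apply: (scalar_le_norm (area (- y))) => {}z z1.
have [|w wV wmax] := vertex_lexmax (- y) x.
  by rewrite areaNl -area_anti.
have [le_w _] := wmax z z1; apply: le_trans le_w _.
by rewrite areaNl -area_anti Vle.
Qed.

Lemma finite_positive_lower_bound (T : eqType) (s : seq T) (phi : T -> R) :
  (forall w, w \in s -> 0 < phi w) ->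
  exists2 e, 0 < e & forall w, w \in s -> e <= phi w.
Proof.
elim: s => [|a s IH] phi0; first by exists 1.
have [|e e0 es] := IH; first by move=> w ws; apply: phi0; rewrite inE ws orbT.
exists (Num.min e (phi a)); first by rewrite lt_min e0 phi0 // mem_head.
move=> w; rewrite inE => /orP[/eqP ->|/es]; first by rewrite ge_min lexx orbT.
by rewrite ge_min => ->.
Qed.

(* The vertices at which [area^~ a] is maximal lie on one side of [v], so that this
   supporting functional can be tilted slightly to the other side. *)
Lemma tilt_support v a : finite_set V -> V v -> 0 < area v a ->
  (forall z, area z a <= area v a * `|z|) ->
  exists2 e, e != 0 & forall w, V w -> area w (a + e *: v) <= area v a.
Proof.
move=> /finite_seqP[s sV] vV h0 amax; set h := area v a.
have wle w : V w -> area w a <= h.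
  by move=> wV; have := amax w; rewrite (vertex_norm1 _ wV) mulr1.
have one_side w1 w2 : V w1 -> V w2 -> area w1 a = h -> area w2 a = h ->
    0 < area w1 v -> area w2 v < 0 -> False.
  move=> w1V w2V w1a w2a w1v w2v.
  have d0 : 0 < area w1 v - area w2 v by lra.
  (* This weight makes [area v] vanish on the combination of [w1] and [w2], which is therefore [v]
     itself. *)
  pose t := - area w2 v / (area w1 v - area w2 v).
  have onem : 1 - t = area w1 v / (area w1 v - area w2 v).
    by rewrite /t; field; rewrite gt_eqF.
  have [] := vertexP _ vV w1 w2 t; rewrite ?(vertex_norm1 _ w1V) ?(vertex_norm1 _ w2V) //.
  - by rewrite divr_gt0 // oppr_gt0.
  - by rewrite -subr_gt0 onem divr_gt0.
  - apply/eqP; rewrite -subr_eq0; apply/eqP; apply: (area_inj f bf v a).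
    + by rewrite gt_eqF.
    + rewrite areaDr areaNr areaDr !areaZr areaxx onem /t.
      by rewrite [area v w1]area_anti [area v w2]area_anti; field; rewrite gt_eqF.
    + rewrite areaDr areaNr areaDr !areaZr area_anti -/h.
      by rewrite [area a w1]area_anti [area a w2]area_anti w1a w2a; ring.
  by move=> w1E _; move: w1v; rewrite w1E areaxx ltxx.
have [sg sg1 sgP] : exists2 sg : R, `|sg| = 1 &
    forall w, V w -> area w a = h -> sg * area w v <= 0.
  have [[w [wV wa wv]]|noW] := pselect (exists w, [/\ V w, area w a = h & 0 < area w v]).
    exists (-1); first by rewrite normrN1.
    move=> w' w'V w'a; rewrite mulN1r oppr_le0 leNgt; apply/negP.
    exact: (one_side w w').
  exists 1; first by rewrite normr1.
  move=> w wV wa; rewrite mul1r leNgt; apply/negP => wv.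
  by apply: noW; exists w.
(* Off the supporting line, [phi w] is a tilt that keeps [w] below [h], with [+ 1] keeping the
   denominator positive; on the line the sign [sg] suffices and [1] is a default. *)
pose phi w := if area w a < h then (h - area w a) / (`|area w v| + 1) else 1.
have [w _|e e0 es] := @finite_positive_lower_bound _ s phi.
  by rewrite /phi; case: ifP => // wa; rewrite divr_gt0 ?subr_gt0 // ltr_wpDl.
have sg0 : sg != 0 by rewrite -normr_gt0 sg1.
exists (e * sg); first by apply: mulf_neq0 => //; rewrite gt_eqF.
move=> w wV; rewrite areaDr areaZr.
have := wle w wV; rewrite le_eqVlt => /orP[/eqP wa|wa].
  by rewrite wa -mulrA; have := sgP _ wV wa; nra.
have := es w; rewrite /phi wa ler_pdivlMr ?ltr_wpDl // => /(_ _)/=.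
have -> : w \in s by have := wV; rewrite sV.
move=> /(_ isT) ew.
have : sg * area w v <= `|area w v|.
  by rewrite (le_trans (ler_norm _)) // normrM sg1 mul1r.
move=> sgw; have : e * (sg * area w v) <= e * `|area w v| by rewrite ler_pM2l.
lra.
Qed.

(** * Widths, dual edges and adjacency *)

Definition area_width (x : X) : R := sup (area x @` @unit_ball R X).

Lemma area_widthE x a : `|a| <= 1 ->
  (forall z, `|z| <= 1 -> area x z <= area x a) -> area_width x = area x a.
Proof.
move=> a1 amax; apply: le_anti; apply/andP; split.
  apply: ge_sup; first by exists (area x a), a.
  by move=> _ [z z1 <-]; exact: amax.
apply: ub_le_sup; last by exists a.
by exists (area x a) => _ [z z1 <-]; exact: amax.
Qed.

Lemma area_widthN x : area_width (- x) = area_width x.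
Proof.
rewrite /area_width; congr sup; apply/seteqP.
by split=> _ [z z1 <-]; exists (- z);
  rewrite /unit_ball /= ?normrN // areaNl areaNr ?opprK.
Qed.

Lemma area_le_vertex v : V v ->
  exists a, [/\ V a, 0 < area v a & forall z, area v z <= area v a * `|z|].
Proof.
move=> vV; have v0 : v != 0 by rewrite -normr_gt0 vertex_norm1.
have [u vu] := area_nondegenerate f bf v v0.
have [|a aV amax] := vertex_lexmax v u; first by rewrite gt_eqF.
have {}amax := scalar_le_norm (area v) _ (fun z z1 => (amax z z1).1).
exists a; split=> //; rewrite ltNge; apply/negP => va.
have := lt_le_trans vu (amax u); rewrite ltNge.
by rewrite mulr_le0_ge0.
Qed.

Lemma vertex_width v : V v ->
  0 < area_width v /\ forall z, area v z <= area_width v * `|z|.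
Proof.
move=> vV; have [a [aV h0 amax]] := area_le_vertex _ vV.
rewrite (area_widthE v a) ?(vertex_norm1 _ aV) // => z z1.
by rewrite (le_trans (amax z)) // ler_piMr // ltW.
Qed.

(** A maximal point [a] of [area v] gives a supporting functional at [v]. Tilting it to
    [y = a + e *: v] gives a second one, and symmetry turns [y] into a second maximal point of
    [area v]. *)
Lemma vertex_dual_edge v : finite_set V -> V v ->
  exists a b, [/\ V a, V b, 0 < area a b &
    [/\ area v a = area_width v, area v b = area_width v,
        area_width a = area_width v & area_width b = area_width v]].
Proof.
move=> finV vV; have v1 := vertex_norm1 _ vV.
have [a [aV h0 amax]] := area_le_vertex _ vV; have a1 := vertex_norm1 _ aV.
have widthv : area_width v = area v a.
  apply: area_widthE; rewrite ?a1 // => z z1.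
  by rewrite (le_trans (amax z)) // ler_piMr // ltW.
(* By symmetry [area^~ c] is maximal at [v], so [area c] is maximal at [- v]. *)
have width c : V c -> area v c = area v a -> area_width c = area v a.
  move=> cV vc; have c1 := vertex_norm1 _ cV.
  have cmax z : area z c <= area v c * `|z|.
    apply: (Radon_plane_area v c v1 c1 _).1; rewrite vc //.
  rewrite -vc area_anti -areaNr; apply: area_widthE; rewrite ?normrN ?v1 // => z z1.
  rewrite areaNr -area_anti area_anti -areaNl (le_trans (cmax _)) // normrN.
  by rewrite ler_piMr // vc ltW.
have [e e0 tilt] := tilt_support v a finV vV h0
  ((Radon_plane_area v a v1 a1 h0).1 amax).
set y := a + e *: v in tilt.
have vy : area v y = area v a by rewrite /y areaDr areaZr areaxx mulr0 addr0.
have ymax z : area z y <= area v y * `|z|.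
  by apply: area_le_vertices; rewrite vy // gt_eqF.
have ny : 0 < `|y|.
  by rewrite normr_gt0; apply/eqP => y0; move: h0; rewrite -vy y0 linear0 ltxx.
(* By symmetry the normalization of [y] maximizes [area v]; comparing its value with the equal
   values at [a] and [y] bounds the norm. *)
have y1 : `|y| <= 1.
  pose y' := `|y|^-1 *: y.
  have ny' : `|y'| = 1 by rewrite normrZ normfV normr_id mulVf // gt_eqF.
  have vy' : area v y' = `|y|^-1 * area v a by rewrite areaZr vy.
  have vy'0 : 0 < area v y' by rewrite vy' mulr_gt0 // invr_gt0.
  have := (Radon_plane_area v y' v1 ny' vy'0).2 _ a.
  rewrite a1 mulr1 vy' -ler_pdivrMr // divff ?gt_eqF // invf_ge1 //; apply => z.
  rewrite areaZr -mulrA ler_pM2l ?invr_gt0 //.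
  by have := ymax z; rewrite vy.
have ay : area a y = - (e * area v a) by rewrite /y areaDr areaZr areaxx add0r area_anti mulrN.
(* The tie-breaking functional vanishes at [a] and equals [e ^+ 2 * area v a > 0] at [y], so [b] is
   not on the line through [0] and [a]. *)
have [|b bV blex] := vertex_lexmax v (- e *: a).
  by rewrite areaZr mulf_neq0 ?oppr_eq0 // gt_eqF.
have b1 := vertex_norm1 _ bV.
have vb : area v b = area v a.
  have b1' : `|b| <= 1 by rewrite b1.
  have a1' : `|a| <= 1 by rewrite a1.
  apply: le_anti; rewrite (blex a a1').1 andbT.
  by rewrite (le_trans (amax b)) // b1 mulr1.
have ab : area a b != 0.
  have [_ /(_ _)] := blex y y1; rewrite vy vb => /(_ erefl); rewrite !areaZl ay mulrNN.
  move=> le_b; apply/eqP => ab0; move: le_b; rewrite ab0 mulr0 mulrA -expr2.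
  by rewrite leNgt mulr_gt0 // lt_neqAle eq_sym sqrf_eq0 e0 sqr_ge0.
have wa := width _ aV erefl; have wb := width _ bV vb.
have [ab0|ba0] := orP (lt_total ab).
  by exists b, a; rewrite widthv wa wb vb; split=> //; rewrite area_anti oppr_gt0.
by exists a, b; rewrite widthv wa wb vb.
Qed.

(** In the expansion of [z] along [a] and [b] the coefficients sum to at most 1 because [area v] is
    maximal at [a] and [b], and to at least 1 by the triangle inequality. So [z] is strictly inside
    a segment of the ball. *)
Lemma vertices_adjacent v a b z :
  V v -> V a -> V b -> V z -> 0 < area a b ->
  area v a = area_width v -> area v b = area_width v ->
  0 < area a z -> 0 < area z b -> False.
Proof.
move=> vV aV bV zV ab va vb az zb.
have [h0 vmax] := vertex_width _ vV.
have zE := area_expand f bf a b z.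
have vz : area v z <= area_width v.
  by rewrite (le_trans (vmax z)) // (vertex_norm1 _ zV) mulr1.
have sum_le : area z b + area a z <= area a b.
  have := congr1 (area v) zE; rewrite areaDr !areaZr va vb => e.
  by rewrite -(ler_pM2r h0) mulrDl -e ler_pM2l.
have sum_ge : area a b <= area z b + area a z.
  have := congr1 Num.norm zE; rewrite normrZ (vertex_norm1 _ zV) mulr1 gtr0_norm // => ->.
  rewrite (le_trans (ler_normD _ _)) // !normrZ (vertex_norm1 _ aV) (vertex_norm1 _ bV).
  by rewrite !mulr1 !gtr0_norm.
have sumE : area a z = area a b - area z b by lra.
have onem : 1 - area z b / area a b = area a z / area a b.
  by rewrite sumE; field; rewrite gt_eqF.
have [] := vertexP _ zV a b (area z b / area a b);
  rewrite ?(vertex_norm1 _ aV) ?(vertex_norm1 _ bV) //.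
- by rewrite divr_gt0.
- by rewrite -subr_gt0 onem divr_gt0.
- rewrite onem ![_ / area a b]mulrC -!scalerA -scalerDr -zE scalerA mulVf ?scale1r //.
  by rewrite gt_eqF.
- by move=> azE; move: az; rewrite azE areaxx ltxx.
Qed.

Lemma vertices_radon_polygon (s : seq X) :
  V = [set` s] -> radon_polygon s area_width area.
Proof.
move=> sV; have sP x : (x \in s) = `[< V x >] by rewrite sV; apply/idP/asboolP.
have finV : finite_set V by apply/finite_seqP; exists s.
split.
- by move=> x; rewrite !sP => /asboolP xV; apply/asboolP; exact: vertex_opp.
- move=> x; rewrite sP => /asboolP xV.
  exact: (vertex_width _ xV).1.
- exact: area_widthN.
- exact: area_anti.
- exact: areaNl.
- exact: area_plucker.
- move=> x y; rewrite !sP => /asboolP xV /asboolP yV.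
  by have := (vertex_width _ xV).2 y; rewrite (vertex_norm1 _ yV) mulr1.
- move=> x y; rewrite !sP => /asboolP xV /asboolP yV xy.
  have x0 : x != 0 by rewrite -normr_gt0 vertex_norm1.
  have [u xu] := area_nondegenerate f bf x x0.
  (* Cramer's rule makes [y] a multiple of [x]; equal norms leave only the sign. *)
  have := area_expand f bf x u y; rewrite xy scale0r addr0 => e.
  have /eqP := congr1 Num.norm e.
  rewrite !normrZ (vertex_norm1 _ xV) (vertex_norm1 _ yV) !mulr1 eqr_norm2.
  move=> /orP[]/eqP yu; [left|right]; apply: (scalerI (lt0r_neq0 xu)).
    by rewrite e yu.
  by rewrite e yu scaleNr scalerN opprK.
- move=> v; rewrite sP => /asboolP vV.
  have [a [b [aV bV ab wab]]] := vertex_dual_edge _ finV vV.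
  by exists a, b; split=> //; rewrite sP; apply/asboolP.
- move=> v a b z; rewrite !sP => /asboolP vV /asboolP aV /asboolP bV /asboolP zV.
  exact: vertices_adjacent.
Qed.

End RadonPlaneArea.

Theorem theorem2p5 (R : realType) (X : completeNormedModType R) (n : nat)
  (dimX : has_dim 2 X) (n_gt0 : (0 < n)%N)
  (polyX : polygonal X) (cardX : @vertices R X #= `I_(4 * n)) :
  ~ Radon_plane X.
Proof.
move=> radonX; case: dimX => -[f' fl bf].
pose f : {linear X -> 'rV[R]_2} := HB.pack f' (GRing.isLinear.Build _ _ _ _ f' fl).
have [A VA] := finite_fsetP.1 polyX.
have rp := vertices_radon_polygon f bf radonX (finmap.enum_fset A) VA.
have sizeA : size (finmap.enum_fset A) = (4 * n)%N.
  by apply/card_eq_fsetP; rewrite -VA.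
(* The vertex count would be both [4 * n] and [4 * k + 2]; [n_gt0] ensures that there is a
   vertex. *)
have [||k] := size_radon_polygon _ _ _ rp; first exact: finmap.fset_uniq.
  by rewrite -size_eq0 sizeA; lia.
by rewrite sizeA; lia.
Qed.
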